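(* Let $M,N\ge 3$ be integers. (1) Let $x\in\{-1,1\}^N$. In the symmetric toroidal Hitomezashi pattern $\mathrm{Cloth}_{N,N}(x,x)$, every nontrivial toroidal Hitomezashi loop has homology class $(1,1)$ if $k(x)>0$, and homology class $(-1,-1)$ if $k(x)<0$. If $k(x)=0$, no nontrivial toroidal Hitomezashi loop exists. (2) Let $x\in\{-1,1\}^N$, $y\in\{-1,1\}^M$. In the toroidal Hitomezashi pattern $\mathrm{Cloth}_{M,N}(x,y)$, the possible homology classes of a nontrivial toroidal Hitomezashi loop are as follows: - if $k(x)\neq 0$ and $k(y)\ne 0$: $\left(\frac{k(x)}{\gcd(x,y)},\frac{k(y)}{\gcd(x,y)}\right)$; - if $k(x)=0$ and $k(y)\neq 0$: $(0,\pm1)$; - if $k(x)\ne 0$ and $k(y)=0$: $(\pm1,0)$; - if $k(x)=k(y)=0$: $(0,\pm1)$ or $(\pm1,0)$. (That is, every nontrivial toroidal Hitomezashi loop of the pattern has its homology class in the indicated list.)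
   Context: Let $M,N\ge3$. $\mathrm{Cloth}_{M,N}$ is the graph with vertex set $\mathbb Z/M\mathbb Z\times\mathbb Z/N\mathbb Z$, with $(i,j)$ adjacent to $(i\pm1,j)$ and $(i,j\pm1)$. For $x\in\{-1,1\}^N$ (indexed by $\mathbb Z/N\mathbb Z$) and $y\in\{-1,1\}^M$ (indexed by $\mathbb Z/M\mathbb Z$), the toroidal Hitomezashi pattern $\mathrm{Cloth}_{M,N}(x,y)$ is the following orientation of $\mathrm{Cloth}_{M,N}$: the horizontal edge $\{(i,j),(i+1,j)\}$ is oriented $(i,j)\to(i+1,j)$ if $x_j=1$ and $(i+1,j)\to(i,j)$ if $x_j=-1$; the vertical edge $\{(i,j),(i,j+1)\}$ is oriented $(i,j)\to(i,j+1)$ if $y_i=1$ and $(i,j+1)\to(i,j)$ if $y_i=-1$. The pattern is symmetric if $M=N$ and $x=y$. A toroidal Hitomezashi loop is a directed circuit (closed directed trail, no repeated edges, considered up to cyclic shift) in $\mathrm{Cloth}_{M,N}(x,y)$ whose edges alternate (cyclically) between vertical and horizontal edges; a loop may pass through a vertex twice. The edge set is partitioned into such loops. For a loop, $\Delta x$ is the number of its edges of the form $(i,j)\to(i+1,j)$ minus the number of its edges of the form $(i+1,j)\to(i,j)$, and $\Delta y$ is the number of its edges of the form $(i,j)\to(i,j+1)$ minus the number of the form $(i,j+1)\to(i,j)$. The homology class of the loop is $(\Delta x/M,\Delta y/N)$. A loop is trivial if its homology class is $(0,0)$ and nontrivial otherwise. For a string $x$ of $\pm1$'s, $k(x)$ is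 the number of $1$'s minus the number of $(-1)$'s in $x$. $\gcd(x,y)$ denotes $\gcd(|k(x)|,|k(y)|)$. *)

(* Defs.v *)
From mathcomp Require Import all_boot all_order all_algebra.

Set Implicit Arguments.
Unset Strict Implicit.
Unset Printing Implicit Defensive.

Import Order.TTheory GRing.Theory Num.Theory.
Local Open Scope ring_scope.

Definition sign_string (n : nat) (x : 'Z_n -> int) : Prop :=
  forall j, x j = 1 \/ x j = -1.

Definition k (n : nat) (x : 'Z_n -> int) : int :=
  #|[set j | x j == 1]|%:Z - #|[set j | x j == -1]|%:Z.

Definition gcd_k (m n : nat) (x : 'Z_m -> int) (y : 'Z_n -> int) : nat :=
  gcdn `|k x|%N `|k y|%N.

(* 'Z_n is Z/nZ only for n >= 2. *)
Definition vertex (M N : nat) : finType := ('Z_M * 'Z_N)%type.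

(* A directed edge is the pair (tail, head).  For M, N >= 3 the graph has no
   loops or multiple edges and the four directions below exclude one another. *)
Definition dart (M N : nat) : finType := (vertex M N * vertex M N)%type.

Section Directions.
Variables M N : nat.
Implicit Type e : dart M N.

Definition east e : bool := e.2 == (e.1.1 + 1, e.1.2).
Definition west e : bool := e.1 == (e.2.1 + 1, e.2.2).
Definition north e : bool := e.2 == (e.1.1, e.1.2 + 1).
Definition south e : bool := e.1 == (e.2.1, e.2.2 + 1).

Definition horizontal e : bool := east e || west e.
Definition vertical e : bool := north e || south e.

Definition alternates e f : bool :=
  (horizontal e && vertical f) || (vertical e && horizontal f).

End Directions.

(* The tail and the head of a horizontal (resp. vertical) edge have the same
   second (resp. first) coordinate, so x and y may be read off the tail u. *)
Definition Cloth_pattern (M N : nat) (x : 'Z_N -> int) (y : 'Z_M -> int) :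
    rel (vertex M N) :=
  fun u v => [|| east (u, v) && (x u.2 == 1),
                 west (u, v) && (x u.2 == -1),
                 north (u, v) && (y u.1 == 1)
               | south (u, v) && (y u.1 == -1)].

Section Loops.
Variables M N : nat.
Implicit Type c : seq (vertex M N).

(* A closed walk is the sequence c of its vertices, the last one being followed
   by the first; vertices may repeat. *)
Definition cyclic_edges c : seq (dart M N) := zip c (rot 1 c).

(* The pattern uses each edge of the graph in one direction only, so uniqueness
   of the directed edges is uniqueness of the edges. *)
Definition hitomezashi_loop (x : 'Z_N -> int) (y : 'Z_M -> int) c : Prop :=
  [/\ c <> [::],
      cycle (Cloth_pattern x y) c,
      uniq (cyclic_edges c)
    & cycle (@alternates M N) (cyclic_edges c)].

Definition Delta_x c : int :=
  (count (@east M N) (cyclic_edges c))%:Z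
  - (count (@west M N) (cyclic_edges c))%:Z.

Definition Delta_y c : int :=
  (count (@north M N) (cyclic_edges c))%:Z
  - (count (@south M N) (cyclic_edges c))%:Z.

(* The quotients are taken in rat, so that nothing is truncated. *)
Definition homology_class c : rat * rat :=
  ((Delta_x c)%:~R / M%:R, (Delta_y c)%:~R / N%:R).

Definition trivial_loop c : Prop := homology_class c = (0, 0).

Definition nontrivial_hitomezashi_loop
    (x : 'Z_N -> int) (y : 'Z_M -> int) c : Prop :=
  hitomezashi_loop x y c /\ ~ trivial_loop c.

End Loops.

(* Main.v *)
(* The turns of a loop never cross, so a loop, lifted to the plane, is a level
   curve: if f and g are the lattice walks with steps y and x (interpolated at
   half-integers), then the midpoints (p, q) of its edges satisfy
   g(q) = f(p) + h with h a half-integer.  Say that the loop closes up after a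
   translation by (aM, bN); then a k(y) = b k(x).
   - If a = 0 and b <> 0, then g is periodic and f takes its maximum on the
     curve at a unique abscissa (the curve could not get past two of them, nor
     could it reach its minimum in between).  Hence the curve passes through
     that abscissa at two consecutive maxima of g, so b = 1 or b = -1.  Likewise
     if b = 0.
   - If a, b <> 0 and k(x) = k(y) = 0, then f and g are periodic and
     max g = max f + h, although h is not an integer.
   - If a, b, k(x), k(y) <> 0, then the last point of the curve where f = L is
     (p, q) with p and q the extremal solutions of f(p) = L and g(q) = L + h.
     By periodicity of these solutions in L, the curve is invariant under the
     primitive vector along (k(x), k(y)); the direction in which the curve
     leaves that last point gives the sign.
   - If x = y and k(x) = 0, then f = g, and a nontrivial loop would give
     max f + h <= max f and min f + h >= min f, that is, h = 0. *)
Require Import Defs.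
From mathcomp Require Import all_boot all_order all_algebra.
From mathcomp Require Import zify ring.

Set Implicit Arguments.
Unset Strict Implicit.
Unset Printing Implicit Defensive.

Import Order.TTheory GRing.Theory Num.Theory.
Local Open Scope ring_scope.

(** * Walks on the integers *)

Definition unit_walk (f : nat -> int) : Prop :=
  forall t, f t.+1 = f t + 1 \/ f t.+1 = f t - 1.

Definition drifting (f : nat -> int) (n : nat) (d : int) : Prop :=
  forall t, f (t + n)%N = f t + d.

Lemma unit_walkN f : unit_walk f -> unit_walk (fun t => - f t).
Proof. by move=> fw t; case: (fw t) => ->; [right | left]; lia. Qed.

Lemma unit_walk_shift f s : unit_walk f -> unit_walk (fun t => f (s + t)%N).
Proof. by move=> fw t; rewrite addnS. Qed.

Lemma driftingN f n d : drifting f n d -> drifting (fun t => - f t) n (- d).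
Proof. by move=> fd t; rewrite fd opprD. Qed.

Lemma driftingM f n d m : drifting f n d -> drifting f (m * n) (m%:Z * d).
Proof.
move=> fd; elim: m => [|m IH] t; first by rewrite mul0n addn0 mul0r addr0.
by rewrite mulSn addnA IH fd; lia.
Qed.

Lemma unit_walk_ivt f v s t :
  unit_walk f -> f s <= v -> v <= f t -> exists u, f u = v.
Proof.
wlog st : f v s t / (s <= t)%N => [hw|] fw fs ft.
  case: (leqP s t) => [st|/ltnW ts]; first exact: (hw f v s t).
  have [|||u fu] := hw (fun t => - f t) (- v) t s ts; try lia.
    exact: (unit_walkN fw).
  by exists u; lia.
elim: t st ft => [|t IH] st ft.
  by exists 0%N; move: st fs; rewrite leqn0 => /eqP->; lia.
case: (ltrgtP v (f t.+1)) ft => // [vt|->] _; last by exists t.+1.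
have [ts|ts] := leqP s t; first by apply: IH => //; case: (fw t); lia.
have sE : s = t.+1 by lia.
by move: fs; rewrite sE; lia.
Qed.

Lemma unit_walk_dist f t : unit_walk f -> f 0%N - t%:Z <= f t.
Proof. by move=> fw; elim: t => [|t IH]; [lia | case: (fw t); lia]. Qed.

Lemma drifting_gt f n d L : unit_walk f -> drifting f n d -> (0 < n)%N ->
  0 < d -> forall t, ((`|L - f 0|%N + n).+1 * n <= t)%N -> L < f t.
Proof.
move=> fw fd n0 d0 t ht.
have := driftingM (t %/ n) fd (t %% n)%N; rewrite addnC -divn_eq => ->.
have := unit_walk_dist (t %% n) fw; have := ltn_pmod t n0.
have : (`|L - f 0|%N + n < t %/ n)%N by rewrite leq_divRL.
by nia.
Qed.

Lemma last_visit_pos f n d L : unit_walk f -> drifting f n d -> (0 < n)%N ->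
  0 < d -> f 0%N <= L -> exists t, f t = L /\ forall u, (t < u)%N -> L < f u.
Proof.
move=> fw fd n0 d0 fL.
have exL : exists t, f t <= L by exists 0%N.
have ubL t : f t <= L -> (t <= (`|L - f 0|%N + n).+1 * n)%N.
  move=> ftL; rewrite leqNgt; apply/negP => /ltnW /(drifting_gt fw fd n0 d0).
  by lia.
case: (ex_maxnP exL ubL) => t ftL tmax; exists t.
have late u : (t < u)%N -> L < f u.
  by rewrite ltnNge => /negP tu; rewrite ltNge; apply/negP => /tmax.
by split=> //; have := late t.+1 (ltnSn t); case: (fw t); lia.
Qed.

Lemma last_visit (f : nat -> int) (n : nat) (d L s : int) :
  unit_walk f -> drifting f n d -> (0 < n)%N ->
  (s = 1 \/ s = -1) -> 0 < s * d -> s * f 0%N <= s * L ->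
  exists t, f t = L /\ forall u, (t < u)%N -> s * L < s * f u.
Proof.
move=> fw fd n0 [] -> sd fL.
  have [|||||t [tL tu]] := @last_visit_pos f n d L; try lia; try by [].
  by exists t; split=> // u /tu; lia.
have [|||||t [tL tu]] := @last_visit_pos (fun t => - f t) n (- d) (- L);
  try lia.
- exact: (unit_walkN fw).
- exact: (driftingN fd).
by exists t; split=> [|u /tu]; lia.
Qed.

(** After time [t] the walk gets arbitrarily far in direction [s] and sweeps every integer on the
    way, so no solution lies at or beyond [P t.+1]; a next step against [s] would force it back
    through [P t]. *)
Lemma last_visit_extremal (g : int -> int) (P : nat -> int) (n : nat)
    (e s : int) (t : nat) :
  unit_walk P -> drifting P n e -> (0 < n)%N ->
  (s = 1 \/ s = -1) -> 0 < s * e ->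
  (forall u, (t < u)%N -> g (P u) <> g (P t)) ->
  (forall p, g p = g (P t) -> s * p <= s * P t) /\ P t.+1 = P t + s.
Proof.
move=> Pw Pd n0 s1 se last.
have far (v : int) : exists u, (t < u)%N /\ s * v < s * P u.
  exists (t.+1 + `|(s * v - s * P t.+1)%R|.+1 * n)%N.
  split; first by rewrite ltn_addr.
  by rewrite (driftingM _ Pd); nia.
have beyond (p : int) : s * P t.+1 <= s * p -> g p <> g (P t).
  have [u [tu pu]] := far p => tp.
  suff [w <-] : exists w, P (t.+1 + w)%N = p by apply: last; rewrite ltn_addr.
  have uE : u = (t.+1 + (u - t.+1))%N by lia.
  have Pw' := unit_walk_shift t.+1 Pw.
  case: s1 => sE; rewrite sE in pu tp.
    apply: (@unit_walk_ivt _ p 0%N (u - t.+1)%N Pw'); rewrite ?addn0 -?uE; lia.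
  apply: (@unit_walk_ivt _ p (u - t.+1)%N 0%N Pw'); rewrite ?addn0 -?uE; lia.
have next : P t.+1 = P t + s.
  apply/eqP; apply/negP => /negP/eqP ne; apply: (beyond (P t)) => //.
  by case: (Pw t) s1 => tE [] sE; subst s; lia.
split=> // p gp; case: (lerP (s * p) (s * P t)) => // lt.
by case: (beyond p) => //; rewrite next; case: s1 => sE; subst s; lia.
Qed.

(** * Level paths of two potentials *)

(* The odd arguments [2j-1] and [2j+1] stand for the two strips adjacent to the
   grid line [j], and the even argument [2j] for the line itself. *)
Record potential (f : int -> int) (l k : int) : Prop := {
  pot_parity : forall q : int, exists z, f q = q + 1 + 2 * z;
  pot_step : forall q : int, f (q + 1) = f q + 1 \/ f (q + 1) = f q - 1;
  pot_even : forall j : int, f (2 * j + 1) + f (2 * j - 1) = 2 * f (2 * j);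
  pot_period : forall q : int, f (q + l) = f q + 2 * k }.

Lemma potential_period (f : int -> int) (l k q m : int) : potential f l k ->
  f (q + l * m) = f q + 2 * k * m.
Proof.
move=> fp; have per := pot_period fp.
suff nper (i : nat) r : f (r + l * i%:Z) = f r + 2 * k * i%:Z.
  case: m => i; first exact: nper.
  have := nper i.+1 (q + l * Negz i).
  have -> : q + l * Negz i + l * i.+1%:Z = q by lia.
  by move=> ->; lia.
elim: i => [|i IH]; first by rewrite !mulr0 !addr0.
have -> : r + l * i.+1%:Z = r + l * i%:Z + l by lia.
by rewrite per IH; lia.
Qed.

Lemma potentialN (f : int -> int) (l k : int) :
  potential f l k -> potential (fun q => - f q) l (- k).
Proof.
case=> par st ev per; split=> q.
- by have [z ->] := par q; exists (- q - 1 - z); lia.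
- by case: (st q) => ->; [right | left]; lia.
- by have := ev q; lia.
- by rewrite per; lia.
Qed.

Lemma potential_walk f l k P : potential f l k -> unit_walk P ->
  unit_walk (f \o P).
Proof.
move=> fp Pw t /=; case: (Pw t) => E.
  by rewrite E; apply: pot_step fp _.
have := pot_step fp (P t.+1); rewrite E subrK.
by case=> ->; [right | left]; lia.
Qed.

Lemma potential_max (f : int -> int) (l : int) : 0 < l -> potential f l 0 ->
  exists p, forall q, f q <= f p.
Proof.
move=> l0 fp.
have [n En] : exists n : nat, l = n.+1%:Z by exists `|l|%N.-1; lia.
pose g (i : 'I_n.+1) := f i%:Z.
exists [arg max_(i > ord0) g i]%O%:Z => q.
case: Order.TotalTheory.arg_maxP => // i _ imax.
have qr : 0 <= (q %% l)%Z < l by rewrite modz_ge0 ?ltz_pmod //; lia.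
have qn : (`|(q %% l)%Z| < n.+1)%N by lia.
have := imax (Ordinal qn) isT; rewrite /g /=.
have -> : `|(q %% l)%Z|%N%:Z = (q %% l)%Z by lia.
by rewrite {2}(divz_eq q l) addrC mulrC (potential_period _ _ fp); lia.
Qed.

(** By [pot_even] the steps on the two sides of a grid line agree, so an even point is never a local
    extremum. *)
Lemma potential_even_neighbours (f : int -> int) (l k p : int) :
  potential f l k -> (exists j, p = 2 * j) ->
  (f (p + 1) = f p + 1 /\ f (p - 1) = f p - 1) \/
  (f (p + 1) = f p - 1 /\ f (p - 1) = f p + 1).
Proof.
move=> fp [j ->].
have -> : f (2 * j - 1) = 2 * f (2 * j) - f (2 * j + 1).
  by rewrite -(pot_even fp j) addrAC subrr add0r.
by case: (pot_step fp (2 * j)) => ->; lia.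
Qed.

Lemma potential_max_odd (f : int -> int) (l k p : int) : potential f l k ->
  (forall q, f q <= f p) -> exists z, p = 2 * z + 1.
Proof.
move=> fp pmax; exists (p %/ 2)%Z.
have [//|E] : p = 2 * (p %/ 2)%Z + 1 \/ p = 2 * (p %/ 2)%Z by lia.
have := pmax (p + 1); have := pmax (p - 1).
have ev : exists j, p = 2 * j by exists (p %/ 2)%Z.
by case: (potential_even_neighbours fp ev) => -[-> ->]; lia.
Qed.

(* [P t] and [Q t] are the coordinates, doubled to be integers, of the midpoint
   of the [t]-th edge. *)
Record level_path (f g : int -> int) (P Q : nat -> int) (h lP lQ a b : int)
    (n : nat) : Prop := {
  lp_P : unit_walk P;
  lp_Q : unit_walk Q;
  lp_level : forall t, g (Q t) = f (P t) + h;
  lp_odd : exists z, h = 2 * z + 1;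
  lp_turn : forall t, f (P t.+1) - f (P t) = (P t.+1 - P t) * (Q t.+1 - Q t);
  lp_n : (0 < n)%N;
  lp_driftP : drifting P n (lP * a);
  lp_driftQ : drifting Q n (lQ * b);
  lp_return : forall t u r r', P u = P t + lP * r -> Q u = Q t + lQ * r' ->
    exists m, r = m * a /\ r' = m * b }.

Lemma level_path_sym f g P Q h lP lQ a b n :
  level_path f g P Q h lP lQ a b n -> level_path g f Q P (- h) lQ lP b a n.
Proof.
case=> Pw Qw lev [z oz] turn n0 dP dQ ret; split=> //.
- by move=> t; rewrite lev; lia.
- by exists (- z - 1); lia.
- by move=> t; rewrite !lev mulrC -turn; lia.
- by move=> t u r r' hr hr'; have [m [-> ->]] := ret t u r' r hr' hr; exists m.
Qed.

(** * The translation [(a, b)] of a level path *)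

Lemma level_path_slope f g P Q h lP lQ kf kg a b n :
  potential f lP kf -> potential g lQ kg ->
  level_path f g P Q h lP lQ a b n -> kf * a = kg * b.
Proof.
move=> fp gp lp; have := lp_level lp (0 + n)%N.
rewrite (lp_driftP lp) (lp_driftQ lp).
rewrite (potential_period _ _ fp) (potential_period _ _ gp) (lp_level lp).
by lia.
Qed.

Lemma drifting_visit (P : nat -> int) (n : nat) (l a s p : int) :
  unit_walk P -> drifting P n (l * a) -> (0 < n)%N -> 0 < l ->
  (s = 1 \/ s = -1) -> 0 < s * a ->
  exists m : nat, forall i : nat, (m <= i)%N ->
  exists t, P t = p + l * (s * i%:Z).
Proof.
(* From this index on, the target is not behind [P 0] in the direction of the drift. *)
move=> Pw Pd n0 l0 s1 sa; exists `|P 0%N - p|%N => i mi.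
wlog s1E : P p a s Pd Pw s1 sa mi / s = 1 => [hw|].
  case: (s1) => sE; first exact: (hw P p a s).
  have [||||||t Pt] := hw (fun t => - P t) (- p) (- a) 1; try lia.
  - by move=> t; rewrite Pd; lia.
  - exact: (unit_walkN Pw).
  by exists t; lia.
subst s; rewrite mul1r in sa *.
apply: (@unit_walk_ivt _ _ 0%N (0 + (i + `|P 0%N - p|%N) * n)%N) => //.
  by nia.
rewrite (driftingM _ Pd).
have la : 1 <= l * a by nia.
have : l * i%:Z <= l * i%:Z * a by nia.
have : `|P 0%N - p|%N%:Z <= `|P 0%N - p|%N%:Z * (l * a) by nia.
lia.
Qed.

Lemma sign_witness (a : int) : a <> 0 ->
  exists s : int, (s = 1 \/ s = -1) /\ 0 < s * a.
Proof.
move=> a0; have [a1|a1] : 0 < a \/ 0 < - a by lia.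
  by exists 1; split; [left | lia].
by exists (-1); split; [right | lia].
Qed.

Lemma level_path_onto f g P Q h lP lQ a b n (p : int) :
  potential f lP 0 -> 0 < lP -> level_path f g P Q h lP lQ a b n -> a <> 0 ->
  exists q, g q = f p + h.
Proof.
move=> fp lP0 lp /sign_witness [s [s1 sa]].
have [m vis] := drifting_visit p (lp_P lp) (lp_driftP lp) (lp_n lp) lP0 s1 sa.
have [t Pt] := vis m (leqnn m); exists (Q t).
by rewrite (lp_level lp) Pt (potential_period _ _ fp) mulr0 mul0r addr0.
Qed.

(** [f p0 + h] is a value of [g] and [g q0 - h] a value of [f], so the maxima differ by exactly [h];
    but both sit at odd arguments, where potentials are even, while [h] is odd. *)
Lemma level_path_diagonal f g P Q h lP lQ a b n :
  potential f lP 0 -> potential g lQ 0 -> 0 < lP -> 0 < lQ ->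
  level_path f g P Q h lP lQ a b n -> a <> 0 -> b <> 0 -> False.
Proof.
move=> fp gp lP0 lQ0 lp a0 b0.
have [p0 pmax] := potential_max lP0 fp; have [q0 qmax] := potential_max lQ0 gp.
have [q gq] := level_path_onto p0 fp lP0 lp a0.
have [p fq] := level_path_onto q0 gp lQ0 (level_path_sym lp) b0.
have [zp zpE] := potential_max_odd fp pmax.
have [zq zqE] := potential_max_odd gp qmax.
have [yp ypE] := pot_parity fp p0; have [yq yqE] := pot_parity gp q0.
have [z oz] := lp_odd lp; have := qmax q; have := pmax p.
by lia.
Qed.

Lemma level_path_symmetric f P Q h lP lQ a b n :
  potential f lP 0 -> 0 < lP -> level_path f f P Q h lP lQ a b n -> a = 0.
Proof.
move=> fp lP0 lp; case: (a =P 0) => // a0; exfalso.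
have [p0 pmax] := potential_max lP0 fp.
have fpN := potentialN fp; rewrite oppr0 in fpN.
have [p1 pmin] := potential_max lP0 fpN.
have [q0 gq0] := level_path_onto p0 fp lP0 lp a0.
have [q1 gq1] := level_path_onto p1 fp lP0 lp a0.
have [z oz] := lp_odd lp; have := pmax q0; have := pmin q1.
by lia.
Qed.

(* The walk cannot go beyond two distinct maxima [P t] and [P u], as [f] would
   exceed the maximum there; it then runs on both sides of the minimum [P v], on
   one of which [f] is smaller. *)
Lemma walk_max_unique (f : int -> int) (l k : int) (P : nat -> int)
    (t u v : nat) :
  potential f l k -> unit_walk P ->
  (forall w, (exists j, P w = 2 * j) \/ f (P v) < f (P w) < f (P t)) ->
  f (P u) = f (P t) -> (forall w, f (P v) <= f (P w) <= f (P t)) ->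
  P t = P u.
Proof.
move=> fp Pw ev.
wlog: t u ev / P t < P u => [hw ut bnd|tu ut bnd].
  case: (ltrgtP (P t) (P u)) => // lt; first exact: hw.
  by apply/esym; apply: hw => //= w; rewrite ut.
(* At both extreme levels the abscissa is even, so [f] is strictly monotone through it. *)
have neigh w : f (P w) = f (P t) \/ f (P w) = f (P v) ->
    (f (P w + 1) = f (P w) + 1 /\ f (P w - 1) = f (P w) - 1) \/
    (f (P w + 1) = f (P w) - 1 /\ f (P w - 1) = f (P w) + 1).
  by move=> wE; apply: (potential_even_neighbours fp); case: (ev w) => //; lia.
have vis (c : int) (x y : nat) : P x <= c -> c <= P y -> exists w, P w = c.
  exact: unit_walk_ivt Pw.
have [w1 w1E] : exists w, P w = P t + 1 by apply: (vis _ t u); lia.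
have [w2 w2E] : exists w, P w = P u - 1 by apply: (vis _ t u); lia.
have b1 := bnd w1; have b2 := bnd w2; rewrite w1E in b1; rewrite w2E in b2.
have tl w : P t <= P w.
  rewrite leNgt; apply/negP => wt.
  have [w' E] : exists w, P w = P t - 1 by apply: (vis _ w t); lia.
  have := bnd w'; rewrite E.
  by case: (neigh t (or_introl erefl)) => -[]; lia.
have ur w : P w <= P u.
  rewrite leNgt; apply/negP => wt.
  have [w' E] : exists w, P w = P u + 1 by apply: (vis _ u w); lia.
  have := bnd w'; rewrite E.
  by case: (neigh u (or_introl ut)) => -[]; lia.
have vt : f (P v) <> f (P t).
  by case: (neigh t (or_introl erefl)) => -[]; lia.
have tv := tl v; have vu := ur v.
have vt' : P v <> P t by move=> E; rewrite E in vt.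
have vu' : P v <> P u by move=> E; rewrite E ut in vt.
have [w3 w3E] : exists w, P w = P v + 1 by apply: (vis _ t u); lia.
have [w4 w4E] : exists w, P w = P v - 1 by apply: (vis _ t u); lia.
have b3 := bnd w3; have b4 := bnd w4; rewrite w3E in b3; rewrite w4E in b4.
by case: (neigh v (or_intror erefl)) => -[]; lia.
Qed.

(** Each potential has parity opposite to its argument and [h] is odd, so [P t] and [Q t] have
    opposite parities: an edge midpoint lies on exactly one grid line. *)
Lemma level_path_even f g P Q h lP lQ kf kg a b n (t : nat) :
  potential f lP kf -> potential g lQ kg ->
  level_path f g P Q h lP lQ a b n -> (exists z, Q t = 2 * z + 1) ->
  exists z, P t = 2 * z.
Proof.
move=> fp gp lp [z Qz]; have [w hw] := lp_odd lp.
have [yP yPE] := pot_parity fp (P t); have [yQ yQE] := pot_parity gp (Q t).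
by have := lp_level lp t; exists (z + yQ - w - yP); lia.
Qed.

Lemma unit_factor (m b s : int) :
  (s = 1 \/ s = -1) -> s = m * b -> b = 1 \/ b = -1.
Proof.
move=> s1 /(congr1 absz); rewrite abszM => /esym sE.
have : (`|m| * `|b|)%N == 1%N by apply/eqP; rewrite sE; lia.
by rewrite muln_eq1 => /andP [_ /eqP]; lia.
Qed.

Lemma level_path_vertical f g P Q h lP lQ kf kg b n :
  potential f lP kf -> potential g lQ kg -> 0 < lQ ->
  level_path f g P Q h lP lQ 0 b n -> b <> 0 -> b = 1 \/ b = -1.
Proof.
move=> fp gp lQ0 lp b0.
have kg0 : kg = 0 by have := level_path_slope fp gp lp; nia.
subst kg; have gpN := potentialN gp; rewrite oppr0 in gpN.
have [q0 qmax] := potential_max lQ0 gp.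
have [q1 qmin] := potential_max lQ0 gpN.
have [s [s1 sb]] := sign_witness b0.
have vis q := drifting_visit q (lp_Q lp) (lp_driftQ lp) (lp_n lp) lQ0 s1 sb.
have [m0 vis0] := vis q0; have [m1 vis1] := vis q1.
(* [t] and [u] are visits to consecutive translates of the maximum [q0], and [v] is a visit to a
   translate of the minimum [q1]. *)
have [t Qt] := vis0 _ (leqnn m0); have [u Qu] := vis0 _ (leqnSn m0).
have [v Qv] := vis1 _ (leqnn m1).
have gE q c : g (q + lQ * c) = g q.
  by rewrite (potential_period _ _ gp) mulr0 mul0r addr0.
have odd w : g (Q w) = g q0 \/ g (Q w) = g q1 -> exists z, P w = 2 * z.
  move=> wE; apply: (level_path_even fp gp lp).
  case: wE => wE; first by apply: (potential_max_odd gp) => q; rewrite wE.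
  by apply: (potential_max_odd gpN) => q; rewrite wE.
have fE w : f (P w) = g (Q w) - h by rewrite (lp_level lp) addrK.
have tu : P t = P u.
  apply: (@walk_max_unique f lP kf P t u v) => //; first exact: lp_P lp.
  - move=> w; rewrite !fE Qt Qv !gE.
    have [?|wt] := eqVneq (g (Q w)) (g q0); first by left; apply: odd; left.
    have [?|wv] := eqVneq (g (Q w)) (g q1); first by left; apply: odd; right.
    by right; have := qmax (Q w); have := qmin (Q w); lia.
  - by rewrite !fE Qt Qu !gE.
  - move=> w; rewrite !fE Qt Qv !gE.
    by have := qmax (Q w); have := qmin (Q w); lia.
(* The path meets its own translate by a single period of [g], so [s] is a multiple of [b]. *)
have [||m [_ sm]] := lp_return lp (t := t) (u := u) (r := 0) (r' := s).
- by rewrite tu mulr0 addr0.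
- by rewrite Qu Qt; lia.
exact: unit_factor s1 sm.
Qed.

(** The last visit of [f \o P] to [L] is also the last visit of [g \o Q] to [L + h], so both
    coordinates are extremal there. The next turn moves them by [sP] and [sQ] and changes [f] by
    [sP * sQ], which must be the direction [s] in which the level drifts off. *)
Lemma level_path_last f g P Q h lP lQ kf kg a b n :
  potential f lP kf -> potential g lQ kg -> 0 < lP -> 0 < lQ ->
  level_path f g P Q h lP lQ a b n -> a <> 0 -> b <> 0 -> kf <> 0 ->
  exists sP sQ s : int, [/\ (sP = 1 \/ sP = -1), (sQ = 1 \/ sQ = -1),
    [/\ 0 < sP * a, 0 < sQ * b & 0 < s * (kf * a)], s = sP * sQ
  & exists L0 : int, forall L : int, s * L0 <= s * L -> exists t,
    [/\ f (P t) = L, forall p : int, f p = L -> sP * p <= sP * P t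
      & forall q : int, g q = L + h -> sQ * q <= sQ * Q t]].
Proof.
move=> fp gp lP0 lQ0 lp a0 b0 k0.
have [sP [sP1 sPa]] := sign_witness a0; have [sQ [sQ1 sQb]] := sign_witness b0.
have [s [s1 ska]] : exists s : int, (s = 1 \/ s = -1) /\ 0 < s * (kf * a).
  by apply: sign_witness; nia.
have n0 := lp_n lp.
have lPa : 0 < sP * (lP * a) by rewrite mulrCA mulr_gt0.
have lQb : 0 < sQ * (lQ * b) by rewrite mulrCA mulr_gt0.
have fd : drifting (f \o P) n (2 * kf * a).
  by move=> t /=; rewrite (lp_driftP lp) (potential_period _ _ fp).
have last (L : int) : s * f (P 0%N) <= s * L -> exists t,
    [/\ f (P t) = L, forall u, (t < u)%N -> s * L < s * f (P u),
      (forall p : int, f p = L -> sP * p <= sP * P t) /\ P t.+1 = P t + sP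
    & (forall q : int, g q = L + h -> sQ * q <= sQ * Q t) /\ Q t.+1 = Q t + sQ].
  move=> L0; have [||t [/= tL tlast]] :=
    last_visit (potential_walk fp (lp_P lp)) fd n0 s1 (L := L).
  - by lia.
  - exact: L0.
  exists t; split=> //.
  - rewrite -tL.
    apply: last_visit_extremal (lp_P lp) (lp_driftP lp) n0 sP1 lPa _.
    by move=> u /tlast; rewrite tL => lt E; rewrite E ltxx in lt.
  - rewrite -tL -(lp_level lp).
    apply: last_visit_extremal (lp_Q lp) (lp_driftQ lp) n0 sQ1 lQb _.
    move=> u /tlast; rewrite !(lp_level lp) tL => lt /addIr E.
    by rewrite E ltxx in lt.
exists sP, sQ, s; split=> //.
  have [t [tL tlast [_ P1] [_ Q1]]] := last _ (lexx _).
  have := tlast t.+1 (ltnSn t); have := lp_turn lp t.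
  have -> : P t.+1 - P t = sP by rewrite P1; lia.
  have -> : Q t.+1 - Q t = sQ by rewrite Q1; lia.
  move=> E; have -> : f (P t.+1) = f (P 0%N) + sP * sQ by rewrite -E tL; lia.
  by case: (s1) (sP1) (sQ1) => -> [] -> [] ->; lia.
by exists (f (P 0%N)) => L /last [t [tL _ [tP _] [tQ _]]]; exists t.
Qed.

Lemma level_path_oblique f g P Q h lP lQ kf kg a b n :
  potential f lP kf -> potential g lQ kg -> 0 < lP -> 0 < lQ ->
  level_path f g P Q h lP lQ a b n -> a <> 0 -> b <> 0 -> kf <> 0 ->
  kg = (gcdn `|kf| `|kg|)%:Z * a /\ kf = (gcdn `|kf| `|kg|)%:Z * b.
Proof.
move=> fp gp lP0 lQ0 lp a0 b0 k0.
have [sP [sQ [s [sP1 sQ1 [sPa sQb ska] sE [L0 last]]]]] :=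
  level_path_last fp gp lP0 lQ0 lp a0 b0 k0.
set d := gcdn _ _.
have d0 : 0 < d%:Z by rewrite ltz_nat gcdn_gt0; lia.
have [kf' kfE] : exists kf' : int, kf = kf' * d%:Z.
  by apply/dvdzP; rewrite dvdzE dvdn_gcdl.
have [kg' kgE] : exists kg' : int, kg = kg' * d%:Z.
  by apply/dvdzP; rewrite dvdzE dvdn_gcdr.
have slope := level_path_slope fp gp lp.
(* With [K] more periods, the second level comes after [L0] along the path,
   whatever the sign of [kf * kg']. *)
pose K : int := `|(kf * kg')%R|%N.
pose r := kg' + a * K; pose r' := kf' + b * K.
have hK : 0 <= s * (kf * r).
  have : K <= s * (kf * a) * K by rewrite ler_peMl //; lia.
  have : - K <= s * (kf * kg').
    by rewrite /K; case: (sP1) (sQ1) sE => -> [] -> ->; lia.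
  by rewrite /r; lia.
have rE : kf * r = kg * r'.
  have : kf * kg' = kg * kf' by rewrite kfE kgE; ring.
  by rewrite /r /r' !mulrDr !mulrA slope => ->.
(* By [rE] the translation by [(lP * r, lQ * r')] carries the solutions at level [L0] to those at
   level [L0 + 2 * (kf * r)], hence extremal points to extremal points. *)
have [t [tL tP tQ]] := last L0 (lexx _).
have [|u [uL uP uQ]] := last (L0 + 2 * (kf * r)); first by lia.
have uPE : P u = P t + lP * r.
  have := uP (P t + lP * r); rewrite (potential_period _ _ fp) tL => le1.
  have := tP (P u + lP * (- r)); rewrite (potential_period _ _ fp) uL => le2.
  have {}le1 := le1 (ltac:(lia)); have {}le2 := le2 (ltac:(lia)).
  by case: (sP1) le1 le2 => ->; lia.
have uQE : Q u = Q t + lQ * r'.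
  have := uQ (Q t + lQ * r'); have := tQ (Q u + lQ * (- r')).
  rewrite !(potential_period _ _ gp) !(lp_level lp) tL uL => le2 le1.
  have {}le1 := le1 (ltac:(lia)); have {}le2 := le2 (ltac:(lia)).
  by case: (sQ1) le1 le2 => ->; lia.
have [m [rm rm']] := lp_return lp uPE uQE.
pose c := m - K.
have kgc : kg' = c * a by rewrite /c; move: rm; rewrite /r; lia.
have kfc : kf' = c * b by rewrite /c; move: rm'; rewrite /r'; lia.
(* [c * d] divides both [kf] and [kg], hence their gcd [d]. *)
have c1 : `|c|%N = 1%N.
  have : (`|c| * d %| d)%N.
    have dk (y : int) : (`|c| * d %| `|(c * y * d%:Z)%R|)%N.
      by rewrite !abszM absz_nat mulnAC dvdn_mulr.
    by rewrite {2}/d dvdn_gcd {1}kfE kfc {1}kgE kgc !dk.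
  by rewrite -{2}(mul1n d) dvdn_pmul2r // dvdn1 => /eqP.
(* In the product of the three sign conditions, [s = sP * sQ] cancels and the sign of [c]
   remains. *)
have c_gt0 : 0 < c.
  have sq (y : int) : y <> 0 -> 0 < y * y.
    by move=> y0; rewrite -expr2 exprn_even_gt0 //=; lia.
  have : 0 < c * d%:Z * (b * b) * (a * a).
    have := mulr_gt0 ska (mulr_gt0 sPa sQb); rewrite sE kfE kfc.
    set e := _ * _; suff -> : e = c * d%:Z * (b * b) * (a * a) by [].
    by rewrite /e; case: (sP1) (sQ1) => -> [] ->; ring.
  by rewrite pmulr_lgt0 ?sq // pmulr_lgt0 ?sq // pmulr_lgt0.
have cE : c = 1 by move: c1 c_gt0; clear; lia.
by rewrite kgE kfE kgc kfc cE; split; lia.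
Qed.

(** * The potential of a sign string *)

Lemma k_sum n (x : 'Z_n -> int) : sign_string x -> k x = \sum_(j : 'Z_n) x j.
Proof.
move=> xs; rewrite /k -!sum1_card !(big_morph Posz PoszD erefl).
rewrite big_mkcond [X in _ - X]big_mkcond -sumrB.
apply: eq_bigr => j _; rewrite !inE.
by case: (xs j) => ->.
Qed.

Lemma k_sum_nat n (x : 'Z_n -> int) : (1 < n)%N -> sign_string x ->
  k x = \sum_(0 <= i < n) x i%:R.
Proof.
move=> n1 xs; rewrite k_sum //.
transitivity (\sum_(0 <= i < (Zp_trunc n).+2) x i%:R).
  by rewrite big_mkord; apply: eq_bigr => i _; rewrite natr_Zp.
by congr bigop; rewrite Zp_cast.
Qed.

(** The discrete primitive, vanishing at 0, of the periodic extension of [x] to the integers; floor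
    division makes it cover negative [j] as well. *)
Definition partial_sum n (x : 'Z_n -> int) (j : int) : int :=
  (j %/ n)%Z * k x + \sum_(0 <= i < `|(j %% n)%Z|%N) x i%:R.

Lemma Zp_intrD_period n (j m : int) : (1 < n)%N ->
  (j + n%:Z * m)%:~R = j%:~R :> 'Z_n.
Proof.
move=> n1.
by rewrite rmorphD rmorphM /= -[n%:Z%:~R]/(n%:R) pchar_Zp // mul0r addr0.
Qed.

Lemma Zp_intr_eq0 n (z : int) : (1 < n)%N -> z%:~R = 0 :> 'Z_n ->
  exists m, z = n%:Z * m.
Proof.
move=> n1; have n0 : n%:Z != 0 by lia.
rewrite {1}(divz_eq z n) addrC mulrC Zp_intrD_period //.
have : 0 <= (z %% n)%Z < n by rewrite modz_ge0 //= ltz_pmod //; lia.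
case E : (z %% n)%Z => [r|//] /= rn.
rewrite -[r%:Z%:~R]/(r%:R) Zp_nat => /(congr1 val) /=.
rewrite Zp_cast // modn_small // => r0.
by exists (z %/ n)%Z; rewrite {1}(divz_eq z n) E r0; lia.
Qed.

Lemma partial_sum_step n (x : 'Z_n -> int) (j : int) :
  (1 < n)%N -> sign_string x ->
  partial_sum x (j + 1) = partial_sum x j + x j%:~R.
Proof.
move=> n1 xs; have n0 : n%:Z != 0 by lia.
rewrite /partial_sum.
have jE : j = (j %% n)%Z + n%:Z * (j %/ n)%Z by rewrite {1}(divz_eq j n); lia.
have : 0 <= (j %% n)%Z < n by rewrite modz_ge0 //= ltz_pmod //; lia.
have -> : x j%:~R = x (j %% n)%Z%:~R by rewrite {1}jE Zp_intrD_period.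
case E : (j %% n)%Z => [r|//] /= rn; rewrite E in jE.
have [rn1|rn1] : (r.+1 < n)%N \/ r.+1 = n by lia.
  have -> : ((j + 1) %% n)%Z = r.+1.
    have -> : j + 1 = (j %/ n)%Z * n + r.+1%:Z by lia.
    by rewrite modzMDl modz_small //; lia.
  have -> : ((j + 1) %/ n)%Z = (j %/ n)%Z.
    have -> : j + 1 = (j %/ n)%Z * n + r.+1%:Z by lia.
    by rewrite divzMDl // (@divz_small r.+1) ?addr0 //; lia.
  by rewrite /= big_nat_recr //= addrA.
(* At the end of a period the remainder sum becomes empty and the quotient gains one: the last term
   completes [k x]. *)
have -> : ((j + 1) %% n)%Z = 0.
  have -> : j + 1 = ((j %/ n)%Z + 1) * n by lia.
  by rewrite modzMl.
have -> : ((j + 1) %/ n)%Z = (j %/ n)%Z + 1.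
  have -> : j + 1 = ((j %/ n)%Z + 1) * n by lia.
  by rewrite mulzK.
rewrite /= big_geq // addr0 -addrA.
have <- : k x = \sum_(0 <= i < r) x i%:R + x r%:Z%:~R;
  last by rewrite mulrDl mul1r.
have -> : k x = \sum_(0 <= i < r.+1) x i%:R.
  by rewrite k_sum_nat //; congr bigop; rewrite rn1.
by rewrite big_nat_recr.
Qed.

Lemma partial_sum_period n (x : 'Z_n -> int) (j : int) :
  (1 < n)%N -> partial_sum x (j + n%:Z) = partial_sum x j + k x.
Proof.
move=> n1; have n0 : n%:Z != 0 by lia.
rewrite /partial_sum modzDr divzDr ?dvdzz // divzz n0 mulrDl mul1r.
by rewrite addrAC.
Qed.

Lemma partial_sum_parity n (x : 'Z_n -> int) (j : int) :
  (1 < n)%N -> sign_string x -> exists z, partial_sum x j = j + 2 * z.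
Proof.
move=> n1 xs; have st (i : int) := partial_sum_step i n1 xs.
elim/int_ind: j => [|m [z IH]|m [z IH]].
- by exists 0; rewrite /partial_sum div0z mod0z big_geq // mul0r addr0.
- have -> : m.+1%:Z = m%:Z + 1 by lia.
  by rewrite st IH; case: (xs m%:Z%:~R) => ->; [exists z | exists (z - 1)]; lia.
- have := st (- m.+1%:Z); have -> : - m.+1%:Z + 1 = - m%:Z by lia.
  rewrite IH; case: (xs (- m.+1%:Z)%:~R) => ->; [exists z | exists (z + 1)];
    lia.
Qed.

Definition string_potential n (x : 'Z_n -> int) (q : int) : int :=
  partial_sum x ((q + 1) %/ 2)%Z + partial_sum x ((q + 2) %/ 2)%Z.

Lemma string_potentialE n (x : 'Z_n -> int) (j : int) :
  (1 < n)%N -> sign_string x ->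
  string_potential x (2 * j + 1) = string_potential x (2 * j) + x j%:~R /\
  string_potential x (2 * j - 1) = string_potential x (2 * j) - x j%:~R.
Proof.
move=> n1 xs; rewrite /string_potential.
have -> : ((2 * j + 1 + 1) %/ 2)%Z = j + 1 by lia.
have -> : ((2 * j + 1 + 2) %/ 2)%Z = j + 1 by lia.
have -> : ((2 * j + 1) %/ 2)%Z = j by lia.
have -> : ((2 * j + 2) %/ 2)%Z = j + 1 by lia.
have -> : ((2 * j - 1 + 1) %/ 2)%Z = j by lia.
have -> : ((2 * j - 1 + 2) %/ 2)%Z = j by lia.
by rewrite partial_sum_step //; lia.
Qed.

Lemma string_potentialP n (x : 'Z_n -> int) : (1 < n)%N -> sign_string x ->
  potential (string_potential x) (2 * n%:Z) (k x).
Proof.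
move=> n1 xs; have spE (j : int) := string_potentialE j n1 xs.
split=> q.
- rewrite /string_potential.
  have [z1 ->] := partial_sum_parity ((q + 1) %/ 2)%Z n1 xs.
  have [z2 ->] := partial_sum_parity ((q + 2) %/ 2)%Z n1 xs.
  by exists (z1 + z2); lia.
- have [E|E] : q = 2 * (q %/ 2)%Z \/ q = 2 * ((q + 1) %/ 2)%Z - 1 by lia.
    move: (q %/ 2)%Z E => j ->; rewrite (spE j).1.
    by case: (xs j%:~R) => ->; [left | right].
  move: ((q + 1) %/ 2)%Z E => j ->; rewrite subrK (spE j).2.
  by case: (xs j%:~R) => ->; [left | right]; lia.
- by rewrite (spE q).1 (spE q).2; lia.
- rewrite /string_potential.
  have -> : ((q + 2 * n%:Z + 1) %/ 2)%Z = ((q + 1) %/ 2)%Z + n%:Z by lia.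
  have -> : ((q + 2 * n%:Z + 2) %/ 2)%Z = ((q + 2) %/ 2)%Z + n%:Z by lia.
  by rewrite !partial_sum_period //; lia.
Qed.

(** * Lifting loops to the plane *)

Lemma nth_rot1 (T : Type) (x0 : T) s i : (i < size s)%N ->
  nth x0 (rot 1 s) i = nth x0 s (i.+1 %% size s).
Proof.
case: s => [|a s] //=; rewrite rot1_cons nth_rcons ltnS leq_eqVlt.
case: (ltngtP i (size s)) => //= [lt|->] _; last by rewrite modnn.
by rewrite modn_small.
Qed.

Lemma cycle_nth (T : Type) (r : rel T) x0 s i : cycle r s -> (i < size s)%N ->
  r (nth x0 s i) (nth x0 s (i.+1 %% size s)).
Proof.
case: s => [|a s] // /(pathP x0) cyc lt.
have := cyc i; rewrite size_rcons -rot1_cons nth_rot1 // => /(_ lt).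
by rewrite rot1_cons -[a :: rcons s a]rcons_cons nth_rcons lt.
Qed.

Lemma cyclic_edges_mkseq M N (v0 : vertex M N) c : cyclic_edges c =
  mkseq (fun t => (nth v0 c (t %% size c), nth v0 c (t.+1 %% size c))) (size c).
Proof.
have sz : size (cyclic_edges c) = size c by rewrite size_zip size_rot minnn.
apply: (@eq_from_nth _ (v0, v0)); rewrite ?size_mkseq sz // => i ic.
by rewrite nth_zip ?size_rot // nth_mkseq // nth_rot1 // (modn_small ic).
Qed.

Lemma count_diff (T : Type) (p q : pred T) s :
  (count p s)%:Z - (count q s)%:Z = \sum_(e <- s) ((p e)%:Z - (q e)%:Z).
Proof.
elim: s => [|e s IH]; first by rewrite big_nil.
by rewrite big_cons -IH /= !PoszD; lia.
Qed.

(** It makes the four directions of a dart mutually exclusive. The product of equations serves as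
    one multirule for [rewrite]. *)
Lemma Zp_no_short_cycle n (i : 'Z_n) : (3 <= n)%N ->
  ((i + 1 == i)%R = false) * ((i == i + 1)%R = false) *
  ((i + 1 + 1 == i)%R = false) * ((i == i + 1 + 1)%R = false).
Proof.
move=> n3; have n1 : (1 < n)%N by apply: leq_trans n3.
have ne1 : (i + 1 == i) = false.
  by rewrite -subr_eq0 addrAC subrr add0r oner_eq0.
have ne2 : (i + 1 + 1 == i) = false.
  rewrite -subr_eq0 addrAC (addrAC i) subrr add0r.
  apply/eqP => /(congr1 val); rewrite -[1 + 1]/(2%:R) Zp_nat /= Zp_cast //.
  by rewrite modn_small.
by rewrite !(eq_sym i) ne1 ne2.
Qed.

Section Pattern.
Variables (M N : nat).
Hypotheses (hM : (3 <= M)%N) (hN : (3 <= N)%N).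
Variables (x : 'Z_N -> int) (y : 'Z_M -> int).
Hypotheses (xs : sign_string x) (ys : sign_string y).

Definition dart_x (e : dart M N) : int := (east e)%:Z - (west e)%:Z.
Definition dart_y (e : dart M N) : int := (north e)%:Z - (south e)%:Z.

Lemma pattern_dart u w : Cloth_pattern x y u w ->
  [/\ horizontal (u, w) && ~~ vertical (u, w), dart_x (u, w) = x u.2,
      dart_y (u, w) = 0 & w = (u.1 + (x u.2)%:~R, u.2)] \/
  [/\ vertical (u, w) && ~~ horizontal (u, w), dart_x (u, w) = 0,
      dart_y (u, w) = y u.1 & w = (u.1, u.2 + (y u.1)%:~R)].
Proof.
case: u w => [i j] [i' j'].
have zM (a : 'Z_M) := Zp_no_short_cycle a hM.
have zN (a : 'Z_N) := Zp_no_short_cycle a hN.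
rewrite /Cloth_pattern /dart_x /dart_y /horizontal /vertical.
rewrite /east /west /north /south /= !xpair_eqE.
case/or4P => /andP [/andP [/eqP iE /eqP jE] /eqP sE]; [left|left|right|right].
all: move: iE jE sE => -> -> ->; rewrite !eqxx !zM !zN /=; split=> //.
- by rewrite rmorphN1 addrK.
- by rewrite rmorphN1 addrK.
Qed.

(* [I] and [J] lift the vertices of a loop with [n] edges to the plane, and
   [hz t] says that the [t]-th edge is horizontal. *)
Record loop_lift (I J : nat -> int) (hz : pred nat) (n : nat) (dI dJ : int)
    : Prop := {
  lift_hz : forall t, hz t.+1 = ~~ hz t;
  lift_horizontal : forall t, hz t ->
    I t.+1 = I t + x (J t)%:~R /\ J t.+1 = J t;
  lift_vertical : forall t, ~~ hz t ->
    I t.+1 = I t /\ J t.+1 = J t + y (I t)%:~R;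
  lift_driftI : drifting I n dI;
  lift_driftJ : drifting J n dJ;
  lift_inj : forall t u,
    (I t)%:~R = (I u)%:~R :> 'Z_M -> (J t)%:~R = (J u)%:~R :> 'Z_N ->
    (I t.+1)%:~R = (I u.+1)%:~R :> 'Z_M ->
    (J t.+1)%:~R = (J u.+1)%:~R :> 'Z_N -> t = u %[mod n] }.

Lemma loop_lift_exists c : hitomezashi_loop x y c ->
  exists I J hz a b, [/\ (0 < size c)%N, Delta_x c = M%:Z * a,
    Delta_y c = N%:Z * b
  & loop_lift I J hz (size c) (Delta_x c) (Delta_y c)].
Proof.
case=> c0 cyc un alt.
have n0 : (0 < size c)%N by case: (c) c0.
(* [v0] is only a default for [nth]: every index is reduced modulo [size c]. *)
have [v0 _] : exists v0 : vertex M N, true.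
  by case: (c) c0 => // a s _; exists a.
pose v t := nth v0 c (t %% size c); pose e t : dart M N := (v t, v t.+1).
have ceE : cyclic_edges c = mkseq e (size c) := cyclic_edges_mkseq v0 c.
have vS t : v t.+1 = nth v0 c ((t %% size c).+1 %% size c).
  by rewrite /v -addn1 -modnDml addn1.
have pat t : Cloth_pattern x y (v t) (v t.+1).
  by rewrite vS; apply: cycle_nth; rewrite // ltn_mod.
have e_mod t : e t = nth (v0, v0) (cyclic_edges c) (t %% size c).
  rewrite ceE nth_mkseq ?ltn_mod // /e !vS modn_mod; congr pair.
  by rewrite /v modn_mod.
have szE : size (cyclic_edges c) = size c by rewrite ceE size_mkseq.
have alte t : alternates (e t) (e t.+1).
  rewrite !e_mod -(addn1 t) -modnDml addn1 -{3}szE.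
  by apply: cycle_nth => //; rewrite szE ltn_mod.
have e_inj t u : e t = e u -> t = u %[mod size c].
  by rewrite !e_mod => /eqP; rewrite nth_uniq ?szE ?ltn_mod // => /eqP.
have e_per t : e (t + size c)%N = e t by rewrite !e_mod modnDr.
(* Running sums of signed displacements lift one coordinate; each turn of the loop adds the full
   sum. *)
have lift (d : dart M N -> int) (i0 : int) : exists I : nat -> int,
    [/\ I 0%N = i0, forall t, I t.+1 = I t + d (e t)
      & drifting I (size c) (\sum_(f <- cyclic_edges c) d f)].
  exists (fun t => i0 + \sum_(0 <= s < t) d (e s)).
  have IS t : i0 + \sum_(0 <= s < t.+1) d (e s) =
      i0 + \sum_(0 <= s < t) d (e s) + d (e t).
    by rewrite big_nat_recr //= addrA.
  split=> //; first by rewrite big_geq // addr0.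
  elim=> [|t IH].
    rewrite add0n [in RHS]big_geq // addr0; congr (_ + _).
    by rewrite ceE big_map /index_iota subn0.
  by rewrite addSn !IS IH e_per addrAC.
have [I [I0 IS Idr]] := lift dart_x (v 0%N).1%:Z.
have [J [J0 JS Jdr]] := lift dart_y (v 0%N).2%:Z.
have step t := pattern_dart (pat t).
have IJv t : ((I t)%:~R, (J t)%:~R) = v t.
  elim: t => [|t IH].
    by rewrite I0 J0 -!pmulrn !natr_Zp; case: (v 0%N).
  rewrite IS JS /e.
  by case: (step t) => -[_ -> -> ->]; rewrite -IH !rmorphD /= addr0.
have Iv t : (I t)%:~R = (v t).1 by rewrite -IJv.
have Jv t : (J t)%:~R = (v t).2 by rewrite -IJv.
have v_per : v (0 + size c)%N = v 0%N by rewrite /v add0n modnn mod0n.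
(* The loop closes up on the torus, so the drift of a lifted coordinate vanishes in ['Z_n]. *)
have winds n (F : nat -> int) d : (3 <= n)%N -> drifting F (size c) d ->
    (F (0 + size c)%N)%:~R = (F 0%N)%:~R :> 'Z_n -> exists m, d = n%:Z * m.
  move=> n3 Fd; rewrite Fd rmorphD /= => E.
  apply: (Zp_intr_eq0 (leq_trans _ n3)) => //.
  by apply: (@addrI _ (F 0%N)%:~R); rewrite E addr0.
have [a aE] : exists a, Delta_x c = M%:Z * a.
  by rewrite /Delta_x count_diff; apply: winds hM Idr _; rewrite !Iv v_per.
have [b bE] : exists b, Delta_y c = N%:Z * b.
  by rewrite /Delta_y count_diff; apply: winds hN Jdr _; rewrite !Jv v_per.
exists I, J, (fun t => horizontal (e t)), a, b; split=> //; split.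
- move=> t; have := alte t; rewrite /alternates /e.
  by case: (step t) => -[/andP []] => -> /negPf -> _ _ _;
    case: (step t.+1) => -[/andP []] => -> /negPf ->.
- rewrite /e => t ht; rewrite IS JS Jv /e.
  by case: (step t) => -[/andP [_]]; rewrite ?ht // => _ -> -> _; rewrite addr0.
- rewrite /e => t ht; rewrite IS JS Iv /e.
  case: (step t) => -[/andP []]; rewrite ?(negPf ht) // => _ _ -> -> _.
  by rewrite addr0.
- by rewrite /Delta_x count_diff.
- by rewrite /Delta_y count_diff.
- move=> t u; rewrite !Iv !Jv => h1 h2 h3 h4; apply: e_inj; rewrite /e.
  by move: h1 h2 h3 h4; case: (v t) => ? ?; case: (v u) => ? ?;
    case: (v t.+1) => ? ?; case: (v u.+1) => ? ? /= -> -> -> ->.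
Qed.

(** The abscissa selects a column and its sign in [y], so [y] supplies the potential along [P], and
    [x] the one along [Q]. *)
Lemma loop_lift_level_path I J hz n a b : (0 < n)%N ->
  loop_lift I J hz n (M%:Z * a) (N%:Z * b) ->
  exists h, level_path (string_potential y) (string_potential x)
    (fun t => I t + I t.+1) (fun t => J t + J t.+1) h
    (2 * M%:Z) (2 * N%:Z) a b n.
Proof.
move=> n0 [hzS hor ver drI drJ inj].
have M1 : (1 < M)%N by apply: leq_trans hM.
have N1 : (1 < N)%N by apply: leq_trans hN.
set P := fun t => I t + I t.+1; set Q := fun t => J t + J t.+1.
pose X (j : int) := x j%:~R; pose Y (i : int) := y i%:~R.
have X1 j : X j = 1 \/ X j = -1 by apply: xs.
have Y1 i : Y i = 1 \/ Y i = -1 by apply: ys.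
have hzE t : hz t -> [/\ P t = 2 * I t + X (J t), Q t = 2 * J t,
    P t.+1 = P t + X (J t) & Q t.+1 = Q t + Y (I t.+1)].
  move=> ht; have [I1 J1] := hor t ht.
  have [I2 J2] : _ /\ _ := ver t.+1 (ltac:(by rewrite hzS ht)).
  by rewrite /P /Q I2 J2 J1 I1 /X /Y; split; lia.
have vtE t : ~~ hz t -> [/\ P t = 2 * I t, Q t = 2 * J t + Y (I t),
    P t.+1 = P t + X (J t.+1) & Q t.+1 = Q t + Y (I t)].
  move=> ht; have [I1 J1] := ver t ht.
  have [I2 J2] : _ /\ _ := hor t.+1 (ltac:(by rewrite hzS ht)).
  by rewrite /P /Q I2 J2 J1 I1 /X /Y; split; lia.
have sp (m : nat) (z : 'Z_m -> int) (m1 : (1 < m)%N) (zs : sign_string z)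
    (j d : int) : d = 1 \/ d = -1 ->
    string_potential z (2 * j + d) = string_potential z (2 * j) + d * z j%:~R.
  move=> [] ->; first by rewrite mul1r; case: (string_potentialE j m1 zs).
  by rewrite mulN1r; case: (string_potentialE j m1 zs).
pose f := string_potential y; pose g := string_potential x.
have fE (i d : int) : d = 1 \/ d = -1 -> f (2 * i + d) = f (2 * i) + d * Y i.
  exact: sp.
have gE (j d : int) : d = 1 \/ d = -1 -> g (2 * j + d) = g (2 * j) + d * X j.
  exact: sp.
have opp1 (d : int) : d = 1 \/ d = -1 -> - d = 1 \/ - d = -1 by lia.
(* At the turn the column [i] meets the row [j]. Next to these lines [f] has slope [Y i] and [g] has
   slope [X j], so both change by [X j * Y i] and their difference stays constant. *)
have turn t : exists i j : int,
    [/\ P t.+1 = P t + X j, Q t.+1 = Q t + Y i,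
        f (P t.+1) = f (P t) + X j * Y i & g (Q t.+1) = g (Q t) + X j * Y i].
  have [ht|ht] := boolP (hz t).
    have [Pt Qt PS QS] := hzE t ht; exists (I t.+1), (J t); split=> //.
      have I1 := (hor t ht).1.
      have -> : P t.+1 = 2 * I t.+1 by rewrite PS Pt I1 /X; lia.
      have -> : P t = 2 * I t.+1 + - X (J t) by rewrite Pt I1 /X; lia.
      by rewrite fE; [lia | apply: opp1].
    by rewrite QS Qt gE // (mulrC (X _)).
  have [Pt Qt PS QS] := vtE t ht; exists (I t), (J t.+1); split=> //.
    by rewrite PS Pt fE //.
  have J1 := (ver t ht).2.
  have -> : Q t.+1 = 2 * J t.+1 by rewrite QS Qt J1 /Y; lia.
  have -> : Q t = 2 * J t.+1 + - Y (I t) by rewrite Qt J1 /Y; lia.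
  by rewrite gE; [lia | apply: opp1].
exists (g (Q 0%N) - f (P 0%N)); split.
- move=> t; have [i [j [-> _ _ _]]] := turn t.
  by case: (X1 j) => ->; [left | right].
- move=> t; have [i [j [_ -> _ _]]] := turn t.
  by case: (Y1 i) => ->; [left | right].
- elim=> [|t IH]; first by rewrite -/f -/g; lia.
  have [i [j [_ _]]] := turn t; rewrite -/f -/g => -> ->.
  by move: IH; rewrite -/f -/g => ->; lia.
- have [zP PE] := pot_parity (string_potentialP M1 ys) (P 0%N).
  have [zQ QE] := pot_parity (string_potentialP N1 xs) (Q 0%N).
  (* A midpoint has exactly one odd doubled coordinate, so the two potentials differ in parity
     there. *)
  suff [w wE] : exists w, P 0%N + Q 0%N = 2 * w + 1.
    by rewrite /f /g PE QE; exists (w + zQ - zP - P 0%N); lia.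
  have [h0|h0] := boolP (hz 0).
    have [-> -> _ _] := hzE 0%N h0; have := X1 (J 0%N).
    by case=> ->; [exists (I 0%N + J 0%N) | exists (I 0%N + J 0%N - 1)]; lia.
  have [-> -> _ _] := vtE 0%N h0; have := Y1 (I 0%N).
  by case=> ->; [exists (I 0%N + J 0%N) | exists (I 0%N + J 0%N - 1)]; lia.
- move=> t; have [i [j [E1 E2]]] := turn t; rewrite -/f -/g => -> _.
  by rewrite E1 E2; lia.
- exact: n0.
- by move=> t; rewrite /P -addSn !drI; lia.
- by move=> t; rewrite /Q -addSn !drJ; lia.
move=> t u r r' Pu Qu.
(* [Q] is even exactly on horizontal edges, and a shift by a multiple of [2 * N] keeps the
   parity. *)
have hzu : hz u = hz t.
  have [ht|ht] := boolP (hz t); have [hu|hu] := boolP (hz u) => //.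
    have [_ Qt _ _] := hzE t ht; have [_ Qu' _ _] := vtE u hu.
    by have := Y1 (I u); lia.
  have [_ Qt _ _] := vtE t ht; have [_ Qu' _ _] := hzE u hu.
  by have := Y1 (I t); lia.
have XE j m : X (j + N%:Z * m) = X j by rewrite /X Zp_intrD_period.
have YE i m : Y (i + M%:Z * m) = Y i by rewrite /Y Zp_intrD_period.
(* The line carrying the edge is recovered first; its sign, the same for both edges, then locates
   the tail from the midpoint. *)
have [Iu Ju] : I u = I t + M%:Z * r /\ J u = J t + N%:Z * r'.
  have [ht|ht] := boolP (hz t).
    have hu : hz u by rewrite hzu.
    have [Pt Qt _ _] := hzE t ht; have [Pu' Qu' _ _] := hzE u hu.
    have Ju : J u = J t + N%:Z * r' by lia.
    by rewrite Ju XE in Pu'; split=> //; lia.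
  have hu : ~~ hz u by rewrite hzu.
  have [Pt Qt _ _] := vtE t ht; have [Pu' Qu' _ _] := vtE u hu.
  have Iu : I u = I t + M%:Z * r by lia.
  by rewrite Iu YE in Qu'; split=> //; lia.
have IuS : I u.+1 = I t.+1 + M%:Z * r by move: Pu; rewrite /P; lia.
have JuS : J u.+1 = J t.+1 + N%:Z * r' by move: Qu; rewrite /Q; lia.
(* Both edges project to the same edge of the torus, which the loop uses only once. *)
have tu : t = u %[mod n].
  by apply: inj; rewrite ?Iu ?Ju ?IuS ?JuS Zp_intrD_period.
(* [t] and [u] differ by whole turns of the loop, and their number does not depend on the coordinate
   [F]. *)
have mult (F : nat -> int) (l d c : int) : 0 < l -> drifting F n (l * d) ->
    F u = F t + l * c -> c = ((u %/ n)%:Z - (t %/ n)%:Z) * d.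
  move=> l0 Fd E; have FE s : F s = F (s %% n)%N + (s %/ n)%:Z * (l * d).
    by rewrite {1}(divn_eq s n) addnC (driftingM _ Fd).
  apply: (mulfI (lt0r_neq0 l0)); rewrite (FE u) (FE t) tu in E.
  by lia.
exists ((u %/ n)%:Z - (t %/ n)%:Z); split.
  by apply: mult drI Iu; lia.
by apply: mult drJ Ju; lia.
Qed.

End Pattern.

(** * Homology classes of loops *)

Lemma loop_level_path M N (x : 'Z_N -> int) (y : 'Z_M -> int) c :
  (3 <= M)%N -> (3 <= N)%N -> sign_string x -> sign_string y ->
  hitomezashi_loop x y c ->
  exists (a b : int) P Q h n, homology_class c = (a%:~R, b%:~R) /\
    level_path (string_potential y) (string_potential x) P Q h
      (2 * M%:Z) (2 * N%:Z) a b n.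
Proof.
move=> hM hN xs ys /(loop_lift_exists hM hN).
case=> I [J [hz [a [b [n0 aE bE]]]]]; rewrite aE bE => lift.
have [h lp] := loop_lift_level_path hM hN xs ys n0 lift.
exists a, b, (fun t => I t + I t.+1), (fun t => J t + J t.+1), h, (size c).
split=> //; rewrite /homology_class aE bE !intrM -!pmulrn.
by congr pair; rewrite mulrC mulKf // pnatr_eq0 -lt0n
  (leq_trans _ hM, leq_trans _ hN).
Qed.

(** The slope relation is kept beside the three alternatives: it excludes the axis-parallel classes
    when [k x] and [k y] are both nonzero, and selects the axis when exactly one vanishes. *)
Lemma nontrivial_loop_class M N (x : 'Z_N -> int) (y : 'Z_M -> int) c :
  (3 <= M)%N -> (3 <= N)%N -> sign_string x -> sign_string y ->
  nontrivial_hitomezashi_loop x y c ->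
  exists a b : int, [/\ homology_class c = (a%:~R, b%:~R), k y * a = k x * b
    & [\/ a = 0 /\ (b = 1 \/ b = -1), b = 0 /\ (a = 1 \/ a = -1)
      | [/\ k x <> 0, k y <> 0, k x = (gcd_k x y)%:Z * a
          & k y = (gcd_k x y)%:Z * b]]].
Proof.
move=> hM hN xs ys [lc nt].
have M1 : (1 < M)%N by apply: leq_trans hM.
have N1 : (1 < N)%N by apply: leq_trans hN.
have [a [b [P [Q [h [n [cE lp]]]]]]] := loop_level_path hM hN xs ys lc.
have fp := string_potentialP M1 ys; have gp := string_potentialP N1 xs.
have lM0 : 0 < 2 * M%:Z by lia.
have lN0 : 0 < 2 * N%:Z by lia.
have slope := level_path_slope fp gp lp.
exists a, b; split=> //.
have [a0|a0] := eqVneq a 0.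
  subst a; constructor 1; split=> //.
  apply: (level_path_vertical fp gp lN0 lp) => b0.
  by apply: nt; rewrite /trivial_loop cE b0.
have [b0|b0] := eqVneq b 0.
  subst b; constructor 2; split=> //.
  by apply: (level_path_vertical gp fp lM0 (level_path_sym lp)); apply/eqP.
have a0' := elimN eqP a0; have b0' := elimN eqP b0.
(* Otherwise the slope relation makes [k x] vanish too, which [level_path_diagonal] excludes. *)
have ky0 : k y <> 0.
  move=> ky0; have kx0 : k x = 0.
    move: slope; rewrite ky0 mul0r => /esym/eqP.
    by rewrite mulf_eq0 (negPf b0) orbF => /eqP.
  rewrite ky0 in fp; rewrite kx0 in gp.
  exact: level_path_diagonal fp gp lM0 lN0 lp a0' b0'.
have kx0 : k x <> 0.
  move=> kx0; move/eqP: slope; rewrite kx0 mul0r mulf_eq0 (negPf a0) orbF.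
  by move/eqP.
constructor 3; split=> //; rewrite /gcd_k gcdnC.
  exact: (level_path_oblique fp gp lM0 lN0 lp a0' b0' ky0).1.
exact: (level_path_oblique fp gp lM0 lN0 lp a0' b0' ky0).2.
Qed.

Lemma symmetric_loop_trivial N (x : 'Z_N -> int) c :
  (3 <= N)%N -> sign_string x -> k x = 0 ->
  hitomezashi_loop x x c -> trivial_loop c.
Proof.
move=> hN xs kx0 lc; have N1 : (1 < N)%N by apply: leq_trans hN.
have [a [b [P [Q [h [n [cE lp]]]]]]] := loop_level_path hN hN xs xs lc.
have fp := string_potentialP N1 xs; rewrite kx0 in fp.
have lN0 : 0 < 2 * N%:Z by lia.
rewrite /trivial_loop cE (level_path_symmetric fp lN0 lp).
by rewrite (level_path_symmetric fp lN0 (level_path_sym lp)).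
Qed.

Theorem theorem1p5 (M N : nat) (hM : (3 <= M)%N) (hN : (3 <= N)%N) :
  (forall x : 'Z_N -> int, sign_string x ->
    [/\ 0 < k x -> forall c : seq (vertex N N),
          nontrivial_hitomezashi_loop x x c -> homology_class c = (1, 1),
        k x < 0 -> forall c : seq (vertex N N),
          nontrivial_hitomezashi_loop x x c -> homology_class c = (-1, -1)
      & k x = 0 -> ~ exists c : seq (vertex N N),
          nontrivial_hitomezashi_loop x x c])
  /\
  (forall (x : 'Z_N -> int) (y : 'Z_M -> int),
    sign_string x -> sign_string y ->
    forall c : seq (vertex M N), nontrivial_hitomezashi_loop x y c ->
    [/\ k x <> 0 -> k y <> 0 ->
          homology_class c = ((k x)%:~R / (gcd_k x y)%:R,
                              (k y)%:~R / (gcd_k x y)%:R),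
        k x = 0 -> k y <> 0 ->
          homology_class c = (0, 1) \/ homology_class c = (0, -1),
        k x <> 0 -> k y = 0 ->
          homology_class c = (1, 0) \/ homology_class c = (-1, 0)
      & k x = 0 -> k y = 0 ->
          [\/ homology_class c = (0, 1), homology_class c = (0, -1),
              homology_class c = (1, 0) | homology_class c = (-1, 0)]]).
Proof.
split=> [x xs | x y xs ys c /(nontrivial_loop_class hM hN xs ys)].
  split=> [kx0 c | kx0 c | kx0 [c [lc nt]]]; last first.
  - exact: nt (symmetric_loop_trivial hN xs kx0 lc).
  - case/(nontrivial_loop_class hN hN xs xs) => a [b [-> slope]].
    (* The slope relation gives [a = b], and [k x] is [a] times its own absolute value. *)
    rewrite /gcd_k gcdnn; case=> [[a0 b1]|[b0 a1]|[_ _ aE bE]]; try nia.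
    have -> : a = -1 by nia.
    have -> : b = -1 by nia.
    by [].
  - case/(nontrivial_loop_class hN hN xs xs) => a [b [-> slope]].
    rewrite /gcd_k gcdnn; case=> [[a0 b1]|[b0 a1]|[_ _ aE bE]]; try nia.
    have -> : a = 1 by nia.
    have -> : b = 1 by nia.
    by [].
case=> a [b [-> slope cls]]; split=> [kx0 ky0|kx0 ky0|kx0 ky0|kx0 ky0].
- case: cls => [[a0 b1]|[b0 a1]|[_ _ aE bE]]; try nia.
  have g0 : (gcd_k x y)%:R != 0 :> rat.
    by rewrite pnatr_eq0; apply/eqP => g0; rewrite g0 mul0r in aE.
  by rewrite {1}aE {1}bE !intrM -!pmulrn !(mulrC (gcd_k x y)%:R) !mulfK.
- case: cls => [[-> [] ->]|[b0 a1]|[]//]; [by left | by right | nia].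
- case: cls => [[a0 b1]|[-> [] ->]|[]//]; [nia | by left | by right].
- by case: cls => [[-> [] ->]|[-> [] ->]|[]//];
    [constructor 1 | constructor 2 | constructor 3 | constructor 4].
Qed.
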